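(* Let $\zeta=\zeta_1+\zeta_2$ be a $2$-Killing vector field on the warped product manifold $M_1\times_fM_2$, where each $\zeta_i$ is the lift of a vector field on $M_i$ (denoted in the same way). Let $r_i$ be the scalar curvature of $(M_i,g_i)$, $i\in\{1,2\}$. Then: (i) $(M_1,g_1,\zeta_1)$ is a hyperbolic Yamabe soliton, with constants $\lambda,\mu\in\mathbb R$ satisfying $\lambda\neq 0$, if and only if there exist $\lambda,\mu\in\mathbb R$ with $\lambda\neq 0$ such that $$\pounds_{\zeta_1}g_1=\frac{\mu-r_1}{\lambda}g_1;$$ (ii) $(M_2,g_2,\zeta_2)$ is a hyperbolic Yamabe soliton, with constants $\lambda,\mu\in\mathbb R$ satisfying $\lambda f^2\neq 2\zeta_1(f^2)$ at every point, if and only if there exist $\lambda,\mu\in\mathbb R$ with $\lambda f^2\neq 2\zeta_1(f^2)$ at every point such that $$\pounds_{\zeta_2}g_2=\frac{(\mu-r_2)f^2+\zeta_1(\zeta_1(f^2))}{\lambda f^2-2\zeta_1(f^2)}g_2.$$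
   Context: Let $(M_i,g_i)$, $i\in\{1,2\}$, be Riemannian manifolds, $M:=M_1\times M_2$, with canonical projections $\pi_i:M\to M_i$, and let $f:M_1\to(0,\infty)$ be a smooth function. The warped product manifold $M_1\times_fM_2$ is $(M,\bar g)$ with $$\bar g=\pi_1^*(g_1)+(\pi_1^*(f))^2\pi_2^*(g_2).$$ The same notation is used for functions and metrics on factor manifolds and for their pullbacks to the product; identities mixing objects from different factors are understood on the product. A vector field $\zeta$ on $(M,\bar g)$ is $2$-Killing if $\pounds_{\zeta}\pounds_{\zeta}\bar g:=\pounds_{\zeta}(\pounds_{\zeta}\bar g)=0$, where $\pounds$ is the Lie derivative. A triple $(N,h,\xi)$, with $(N,h)$ a Riemannian manifold and $\xi$ a smooth vector field on $N$, is a hyperbolic Yamabe soliton with constants $\lambda,\mu\in\mathbb R$ if $\pounds_{\xi}\pounds_{\xi}h+\lambda\pounds_{\xi}h=(\mu-r)h$, where $r$ is the scalar curvature of $(N,h)$. *)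

(* Defs.v *)
From HB Require Import structures.
From mathcomp Require Import all_boot all_order all_algebra.
From mathcomp Require Import all_classical all_reals all_analysis.
Set Implicit Arguments.
Unset Strict Implicit.
Unset Printing Implicit Defensive.
Import Order.TTheory GRing.Theory Num.Theory.
Import numFieldNormedType.Exports.
Local Open Scope classical_set_scope.
Local Open Scope ring_scope.

Definition partial (R : realType) (n : nat) (k : 'I_n) (F : 'rV[R]_n -> R) :
    'rV[R]_n -> R :=
  fun u => 'D_(delta_mx 0 k) F u.

Fixpoint iter_partial (R : realType) (n : nat) (s : seq 'I_n)
    (F : 'rV[R]_n -> R) : 'rV[R]_n -> R :=
  if s is k :: s' then partial k (iter_partial s' F) else F.

(* C^oo on an open set: the iterated partial derivatives of all orders exist
   and are continuous there. *)
Definition smooth_on (R : realType) (n : nat) (U : set 'rV[R]_n)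
    (F : 'rV[R]_n -> R) : Prop :=
  forall (s : seq 'I_n) (u : 'rV[R]_n), U u ->
    {for u, continuous (iter_partial s F)} /\
    (forall k, derivable (iter_partial s F) u (delta_mx 0 k)).

(* [chart_map c] is meaningful on [chart_dom c] only, and its inverse
   [chart_inv c] on [chart_img c] only. *)
Record atlas (R : realType) (n : nat) := Atlas {
  points : topologicalType;
  chart : Type;
  chart_dom : chart -> set points;
  chart_map : chart -> points -> 'rV[R]_n;
  chart_inv : chart -> 'rV[R]_n -> points
}.

Definition chart_img (R : realType) (n : nat) (M : atlas R n) (c : chart M) :
    set 'rV[R]_n :=
  chart_map c @` chart_dom c.

Definition overlap (R : realType) (n : nat) (M : atlas R n) (c d : chart M) :
    set 'rV[R]_n :=
  [set u | chart_img c u /\ chart_dom d (chart_inv c u)].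

Definition transition (R : realType) (n : nat) (M : atlas R n) (c d : chart M) :
    'rV[R]_n -> 'rV[R]_n :=
  fun u => chart_map d (chart_inv c u).

Record smooth_manifold (R : realType) (n : nat) (M : atlas R n) : Prop := {
  manifold_nonempty : [set: points M] !=set0;
  manifold_hausdorff : hausdorff_space (points M);
  manifold_second_countable : @second_countable (points M);
  manifold_cover : forall x : points M, exists c : chart M, chart_dom c x;
  chart_dom_open : forall c : chart M, open (chart_dom c);
  chart_img_open : forall c : chart M, open (chart_img c);
  chart_mapK : forall (c : chart M) (x : points M),
    chart_dom c x -> chart_inv c (chart_map c x) = x;
  chart_map_continuous : forall (c : chart M) (x : points M),
    chart_dom c x -> {for x, continuous (chart_map c)};
  chart_inv_continuous : forall (c : chart M) (u : 'rV[R]_n),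
    chart_img c u -> {for u, continuous (chart_inv c)};
  transition_smooth : forall (c d : chart M) (j : 'I_n),
    smooth_on (overlap c d) (fun u => transition c d u 0 j)
}.

(* Scalar fields, vector fields and (0,2)-tensor fields are given by their
   components in every chart: [T c u] lists the components, at the point with
   coordinates [u] in the chart [c], with respect to the coordinate fields of
   [c]. Values at [u] outside [chart_img c] are irrelevant. *)
Definition scalar_field (R : realType) (n : nat) (M : atlas R n) : Type :=
  chart M -> 'rV[R]_n -> R.
Definition vector_field (R : realType) (n : nat) (M : atlas R n) : Type :=
  chart M -> 'rV[R]_n -> 'rV[R]_n.
Definition tensor_field (R : realType) (n : nat) (M : atlas R n) : Type :=
  chart M -> 'rV[R]_n -> 'M[R]_n.

Definition tensor_eq (R : realType) (n : nat) (M : atlas R n)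
    (S T : tensor_field M) : Prop :=
  forall (c : chart M) (u : 'rV[R]_n), chart_img c u -> S c u = T c u.

Definition vector_eq (R : realType) (n : nat) (M : atlas R n)
    (X Y : vector_field M) : Prop :=
  forall (c : chart M) (u : 'rV[R]_n), chart_img c u -> X c u = Y c u.

Definition local_expr (R : realType) (n : nat) (M : atlas R n)
    (f : points M -> R) : scalar_field M :=
  fun c u => f (chart_inv c u).

Definition smooth_fun (R : realType) (n : nat) (M : atlas R n)
    (f : points M -> R) : Prop :=
  forall c : chart M, smooth_on (chart_img c) (local_expr f c).

(* The library's Jacobian acts on row vectors from the right:
   ('J F u) i k is the i-th partial derivative of the k-th component of F. *)
Record smooth_vector_field (R : realType) (n : nat) (M : atlas R n)
    (X : vector_field M) : Prop := {
  vector_field_smooth : forall (c : chart M) (k : 'I_n),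
    smooth_on (chart_img c) (fun u => X c u 0 k);
  vector_field_transform : forall (c d : chart M) (u : 'rV[R]_n),
    overlap c d u ->
    X d (transition c d u) = X c u *m 'J (transition c d) u
}.

Record riemannian_metric (R : realType) (n : nat) (M : atlas R n)
    (g : tensor_field M) : Prop := {
  metric_smooth : forall (c : chart M) (i j : 'I_n),
    smooth_on (chart_img c) (fun u => g c u i j);
  metric_transform : forall (c d : chart M) (u : 'rV[R]_n),
    overlap c d u ->
    g c u = 'J (transition c d) u *m g d (transition c d u)
              *m ('J (transition c d) u)^T;
  metric_sym : forall (c : chart M) (u : 'rV[R]_n),
    chart_img c u -> (g c u)^T = g c u;
  metric_posdef : forall (c : chart M) (u v : 'rV[R]_n),
    chart_img c u -> v != 0 -> 0 < (v *m g c u *m v^T) 0 0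
}.

Definition vf_apply (R : realType) (n : nat) (M : atlas R n)
    (X : vector_field M) (phi : scalar_field M) : scalar_field M :=
  fun c u => \sum_(k < n) X c u 0 k * partial k (phi c) u.

(* Components of (L_X T)(Y, Z) = X (T (Y, Z)) - T ([X, Y], Z) - T (Y, [X, Z])
   on the coordinate fields Y = d_i, Z = d_j, for which
   [X, d_i] = - \sum_k (d_i X^k) d_k. *)
Definition lie_derivative (R : realType) (n : nat) (M : atlas R n)
    (X : vector_field M) (T : tensor_field M) : tensor_field M :=
  fun c u => \matrix_(i < n, j < n)
    (\sum_(k < n) X c u 0 k * partial k (fun v => T c v i j) u
     + \sum_(k < n) partial i (fun v => X c v 0 k) u * T c u k j
     + \sum_(k < n) partial j (fun v => X c v 0 k) u * T c u i k).

(* [christoffel g c k i j u] is Gamma^k_ij, i.e. the d_k-component of the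
   Levi-Civita derivative of d_j along d_i. *)
Definition christoffel (R : realType) (n : nat) (M : atlas R n)
    (g : tensor_field M) (c : chart M) (k i j : 'I_n) : 'rV[R]_n -> R :=
  fun u => 2^-1 * \sum_(l < n) invmx (g c u) k l *
    (partial i (fun v => g c v j l) u + partial j (fun v => g c v i l) u
     - partial l (fun v => g c v i j) u).

(* [riemann g c l k i j u] is the d_l-component of Riem(d_i, d_j) d_k, where
   Riem(X, Y) Z = D_X (D_Y Z) - D_Y (D_X Z) - D_[X,Y] Z. *)
Definition riemann (R : realType) (n : nat) (M : atlas R n)
    (g : tensor_field M) (c : chart M) (l k i j : 'I_n) : 'rV[R]_n -> R :=
  fun u => partial i (christoffel g c l j k) u
    - partial j (christoffel g c l i k) u
    + \sum_(m < n) (christoffel g c l i m u * christoffel g c m j k u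
                    - christoffel g c l j m u * christoffel g c m i k u).

(* Ric(Y, Z) is the trace of X |-> Riem(X, Y) Z. *)
Definition ricci (R : realType) (n : nat) (M : atlas R n)
    (g : tensor_field M) : tensor_field M :=
  fun c u => \matrix_(j < n, k < n) \sum_(i < n) riemann g c i k i j u.

Definition scalar_curvature (R : realType) (n : nat) (M : atlas R n)
    (g : tensor_field M) : scalar_field M :=
  fun c u => \sum_(j < n) \sum_(k < n) invmx (g c u) j k * ricci g c u j k.

Definition two_killing (R : realType) (n : nat) (M : atlas R n)
    (g : tensor_field M) (X : vector_field M) : Prop :=
  tensor_eq (lie_derivative X (lie_derivative X g)) (fun _ _ => 0).

Definition hyperbolic_yamabe_soliton (R : realType) (n : nat) (M : atlas R n)
    (h : tensor_field M) (X : vector_field M) (lam mu : R) : Prop :=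
  tensor_eq
    (fun c u => lie_derivative X (lie_derivative X h) c u
                + lam *: lie_derivative X h c u)
    (fun c u => (mu - scalar_curvature h c u) *: h c u).

Definition prod_atlas (R : realType) (m n : nat) (M : atlas R m)
    (N : atlas R n) : atlas R (m + n) :=
  @Atlas R (m + n) (points M * points N)%type (chart M * chart N)%type
    (fun c => chart_dom c.1 `*` chart_dom c.2)
    (fun c x => row_mx (chart_map c.1 x.1) (chart_map c.2 x.2))
    (fun c w => (chart_inv c.1 (lsubmx w), chart_inv c.2 (rsubmx w))).

(* Pullbacks along the projections and lifts of vector fields, in product
   charts: the first m coordinates are those of M, the last n those of N. *)
Section Product.
Context (R : realType) (m n : nat) (M : atlas R m) (N : atlas R n).

Definition pull_scalar1 (phi : scalar_field M) :
    scalar_field (prod_atlas M N) := fun c w => phi c.1 (lsubmx w).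

Definition pull_scalar2 (phi : scalar_field N) :
    scalar_field (prod_atlas M N) := fun c w => phi c.2 (rsubmx w).

Definition pull_tensor1 (T : tensor_field M) :
    tensor_field (prod_atlas M N) :=
  fun c w => block_mx (T c.1 (lsubmx w)) 0 0 0.

Definition pull_tensor2 (T : tensor_field N) :
    tensor_field (prod_atlas M N) :=
  fun c w => block_mx 0 0 0 (T c.2 (rsubmx w)).

Definition lift1 (X : vector_field M) : vector_field (prod_atlas M N) :=
  fun c w => row_mx (X c.1 (lsubmx w)) 0.

Definition lift2 (Y : vector_field N) : vector_field (prod_atlas M N) :=
  fun c w => row_mx 0 (Y c.2 (rsubmx w)).

Definition warped_metric (g1 : tensor_field M) (f : points M -> R)
    (g2 : tensor_field N) : tensor_field (prod_atlas M N) :=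
  fun c w => pull_tensor1 g1 c w
             + pull_scalar1 (local_expr f) c w ^+ 2 *: pull_tensor2 g2 c w.

End Product.

(* Main.v *)
Require Import Defs.
From HB Require Import structures.
From mathcomp Require Import all_boot all_order all_algebra.
From mathcomp Require Import all_classical all_reals all_analysis.
From mathcomp Require Import ssrAC.
Set Implicit Arguments.
Unset Strict Implicit.
Unset Printing Implicit Defensive.
Import Order.TTheory GRing.Theory Num.Theory.
Import numFieldNormedType.Exports.
Local Open Scope classical_set_scope.
Local Open Scope ring_scope.

(** The Lie derivative is natural under products and satisfies the Leibniz rule,
    so for zeta = zeta1 + zeta2, with zeta1 acting on the base only and zeta2 on
    the fiber only,

      L L (g1 + f^2 g2) = L1 L1 g1
        + zeta1 (zeta1 (f^2)) g2 + 2 zeta1 (f^2) L2 g2 + f^2 L2 L2 g2,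

    where L, L1 and L2 are the Lie derivatives along zeta, zeta1 and zeta2
    ([lie_derivative2_warped]). The first term has base components only and the
    other three have fiber components only, hence the 2-Killing equation says
    that L1 L1 g1 = 0 ([two_killing_base]) and that

      zeta1 (zeta1 (f^2)) g2 + 2 zeta1 (f^2) L2 g2 + f^2 L2 L2 g2 = 0

    at every pair of points ([two_killing_fiber]).

    (i) With L1 L1 g1 = 0 the soliton equation is lambda L1 g1 = (mu - r1) g1,
    and lambda can be divided out.

    (ii) Multiplying the soliton equation of the fiber by f^2 <> 0 and
    eliminating f^2 L2 L2 g2 by the second identity leaves

      (lambda f^2 - 2 zeta1 (f^2)) L2 g2
        = ((mu - r2) f^2 + zeta1 (zeta1 (f^2))) g2,

    in which the coefficient of L2 g2 is invertible ([soliton_quotientP]).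

    Both parts need a point of the other factor: identities on one factor are
    read off identities on the product, so the argument uses that manifolds are
    nonempty. The computation in coordinates rests on the fact that a function
    of the base coordinates composed with the projection has the expected base
    partial derivatives and vanishing fiber partial derivatives, and
    symmetrically ([derive_comp_linear]). *)

(** * Partial derivatives on open sets *)

Section Partial.
Context (R : realType) (n : nat).
Implicit Types (U : set 'rV[R]_n) (F G : 'rV[R]_n -> R).

Lemma partial_eq_on U F G u k : open U -> U u ->
  (forall v, U v -> F v = G v) -> partial k F u = partial k G u.
Proof.
move=> oU Uu FG; apply: near_eq_derive.
near=> v; apply: FG; near: v; exact: open_nbhs_nbhs.
Unshelve. all: by end_near. Qed.

Definition pderivable U F : Prop :=
  forall u, U u -> forall k, derivable F u (delta_mx 0 k).

(** The class of functions whose Lie derivatives can be differentiated once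
    more; two derivatives are all that iterating the Lie derivative twice
    consumes. *)
Definition pderivable2 U F : Prop :=
  pderivable U F /\ forall k, pderivable U (partial k F).

(** The partial derivatives of a product are known on [U] only, so their own
    derivability has to be transported along an equality valid on [U]. *)
Lemma pderivable_eq_on U F G : open U -> (forall v, U v -> F v = G v) ->
  pderivable U F -> pderivable U G.
Proof.
move=> oU FG dF u Uu k.
apply: near_eq_derivable (dF u Uu k).
near=> v; apply: FG; near: v; exact: open_nbhs_nbhs.
Unshelve. all: by end_near. Qed.

Lemma pderivableD U F G :
  pderivable U F -> pderivable U G -> pderivable U (fun v => F v + G v).
Proof. by move=> dF dG u Uu k; apply: derivableD; [exact: dF|exact: dG]. Qed.

Lemma pderivableM U F G :
  pderivable U F -> pderivable U G -> pderivable U (fun v => F v * G v).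
Proof. by move=> dF dG u Uu k; apply: derivableM; [exact: dF|exact: dG]. Qed.

Lemma pderivable_sum U p (F : 'I_p -> 'rV[R]_n -> R) :
  (forall l, pderivable U (F l)) -> pderivable U (fun v => \sum_(l < p) F l v).
Proof.
move=> dF u Uu k.
have -> : (fun v => \sum_(l < p) F l v) = \sum_(l < p) F l.
  by apply/funext => v; rewrite fct_sumE.
by apply: derivable_sum => l; exact: dF.
Qed.

Lemma partialD F G u k :
  derivable F u (delta_mx 0 k) -> derivable G u (delta_mx 0 k) ->
  partial k (fun v => F v + G v) u = partial k F u + partial k G u.
Proof. exact: deriveD. Qed.

Lemma partialM F G u k :
  derivable F u (delta_mx 0 k) -> derivable G u (delta_mx 0 k) ->
  partial k (fun v => F v * G v) u = F u * partial k G u + G u * partial k F u.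
Proof. exact: deriveM. Qed.

Lemma pderivable2M U F G : open U ->
  pderivable2 U F -> pderivable2 U G -> pderivable2 U (fun v => F v * G v).
Proof.
move=> oU [dF ddF] [dG ddG]; split=> [|k]; first exact: pderivableM dF dG.
have dFG : pderivable U (fun v => F v * partial k G v + G v * partial k F v).
  by apply: pderivableD; apply: pderivableM; [|exact: ddG| |exact: ddF].
apply: pderivable_eq_on oU _ dFG => v Uv.
exact/esym/(partialM (dF v Uv k) (dG v Uv k)).
Qed.

Lemma smooth_on_pderivable2 U F : smooth_on U F -> pderivable2 U F.
Proof.
move=> sF; split=> [u Uu k|l u Uu k]; first exact: (sF [::] u Uu).2.
exact: (sF [:: l] u Uu).2.
Qed.

Lemma partial_ext F G u k : F =1 G -> partial k F u = partial k G u.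
Proof. by move=> /funext ->. Qed.

Lemma partial_fun0 F u k : (forall v, F v = 0) -> partial k F u = 0.
Proof. by move=> /funext ->; exact: derive_cst. Qed.

End Partial.

(** * Partial derivatives of functions of one factor *)

Section ProductDerivatives.
Context (R : realType) (m n : nat).
Local Notation lsub := (@lsubmx R 1 m n).
Local Notation rsub := (@rsubmx R 1 m n).

(** The growth rates of [F \o L] along [v] are those of [F] along [L v], so
    this chain rule requires no total differentiability of [F]. *)
Lemma growth_rate_comp_linear p q (L : {linear 'rV[R]_p -> 'rV[R]_q})
    (F : 'rV[R]_q -> R) w v :
  (fun h : R => h^-1 *: (((fun x => F (L x)) \o shift w) (h *: v) - F (L w))) =
  (fun h : R => h^-1 *: ((F \o shift (L w)) (h *: L v) - F (L w))).
Proof. by apply/funext => h; congr (_ *: (F _ - _)); exact: linearP. Qed.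

Lemma derivable_comp_linear p q (L : {linear 'rV[R]_p -> 'rV[R]_q})
    (F : 'rV[R]_q -> R) w v :
  derivable F (L w) (L v) -> derivable (fun x => F (L x)) w v.
Proof. by rewrite /derivable growth_rate_comp_linear. Qed.

Lemma derive_comp_linear p q (L : {linear 'rV[R]_p -> 'rV[R]_q})
    (F : 'rV[R]_q -> R) w v :
  'D_v (fun x => F (L x)) w = 'D_(L v) F (L w).
Proof. by rewrite /derive growth_rate_comp_linear. Qed.

Lemma lsub_delta_l k : lsub (delta_mx 0 (lshift n k)) = delta_mx 0 k.
Proof. by apply/rowP => j; rewrite !mxE (inj_eq (@lshift_inj _ _)). Qed.

Lemma lsub_delta_r k : lsub (delta_mx 0 (rshift m k)) = 0.
Proof. by apply/rowP => j; rewrite !mxE eq_lrshift. Qed.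

Lemma rsub_delta_l k : rsub (delta_mx 0 (lshift n k)) = 0.
Proof. by apply/rowP => j; rewrite !mxE eq_rlshift. Qed.

Lemma rsub_delta_r k : rsub (delta_mx 0 (rshift m k)) = delta_mx 0 k.
Proof. by apply/rowP => j; rewrite !mxE (inj_eq (@rshift_inj _ _)). Qed.

Lemma partial_l_lsub (F : 'rV[R]_m -> R) w k :
  partial (lshift n k) (fun v => F (lsub v)) w = partial k F (lsub w).
Proof. by rewrite /partial (derive_comp_linear lsub) /= lsub_delta_l. Qed.

Lemma partial_r_lsub (F : 'rV[R]_m -> R) w k :
  partial (rshift m k) (fun v => F (lsub v)) w = 0.
Proof.
by rewrite /partial (derive_comp_linear lsub) /= lsub_delta_r derive0.
Qed.

Lemma partial_l_rsub (F : 'rV[R]_n -> R) w k :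
  partial (lshift n k) (fun v => F (rsub v)) w = 0.
Proof.
by rewrite /partial (derive_comp_linear rsub) /= rsub_delta_l derive0.
Qed.

Lemma partial_r_rsub (F : 'rV[R]_n -> R) w k :
  partial (rshift m k) (fun v => F (rsub v)) w = partial k F (rsub w).
Proof. by rewrite /partial (derive_comp_linear rsub) /= rsub_delta_r. Qed.

Lemma derivable_lsub (F : 'rV[R]_m -> R) w :
  (forall k, derivable F (lsub w) (delta_mx 0 k)) ->
  forall k, derivable (fun v => F (lsub v)) w (delta_mx 0 k).
Proof.
move=> dF k; apply: (derivable_comp_linear (L := lsub)).
case: (split_ordP k) => l ->; first by rewrite /= lsub_delta_l.
by rewrite /= lsub_delta_r; exact: derivable0.
Qed.

Lemma derivable_rsub (F : 'rV[R]_n -> R) w :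
  (forall k, derivable F (rsub w) (delta_mx 0 k)) ->
  forall k, derivable (fun v => F (rsub v)) w (delta_mx 0 k).
Proof.
move=> dF k; apply: (derivable_comp_linear (L := rsub)).
case: (split_ordP k) => l ->; last by rewrite /= rsub_delta_r.
by rewrite /= rsub_delta_l; exact: derivable0.
Qed.

End ProductDerivatives.

(* Unification must compare partial derivatives by their arguments instead of
   unfolding them into limits. *)
Opaque partial pderivable.

(** * Locality and additivity of the Lie derivative *)

Section LieDerivative.
Context (R : realType) (n : nat) (M : atlas R n).
Implicit Types (X Y : vector_field M) (S T : tensor_field M) (c : chart M).

(** The components of a Lie derivative at a point involve first derivatives of
    both arguments, so the arguments matter on a neighborhood of the point. This
    lets one replace fields that agree on the image of a chart, outside of which
    their components are arbitrary. *)
Lemma lie_derivative_eq_on X Y S T c u :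
  open (chart_img c) -> chart_img c u ->
  (forall v, chart_img c v -> X c v = Y c v) ->
  (forall v, chart_img c v -> S c v = T c v) ->
  lie_derivative X S c u = lie_derivative Y T c u.
Proof.
move=> oc cu XY ST; apply/matrixP => i j; rewrite !mxE.
congr (_ + _ + _); apply: eq_bigr => k _; rewrite ?XY ?ST//; congr (_ * _);
  by apply: (partial_eq_on _ oc cu) => v cv; rewrite ?XY ?ST.
Qed.

Lemma lie_derivativeD X S T c u :
  (forall i j k, derivable (fun v => S c v i j) u (delta_mx 0 k)) ->
  (forall i j k, derivable (fun v => T c v i j) u (delta_mx 0 k)) ->
  lie_derivative X (fun d v => S d v + T d v) c u =
  lie_derivative X S c u + lie_derivative X T c u.
Proof.
move=> dS dT; apply/matrixP => i j; rewrite !mxE.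
have partialST k : partial k (fun v => (S c v + T c v) i j) u =
    partial k (fun v => S c v i j) u + partial k (fun v => T c v i j) u.
  rewrite -(partialD (dS i j k) (dT i j k)); apply: partial_ext => v.
  exact: mxE.
under eq_bigr => k _ do rewrite partialST mulrDr.
under [X in _ + X + _ = _]eq_bigr => k _ do rewrite mxE mulrDr.
under [X in _ + _ + X = _]eq_bigr => k _ do rewrite mxE mulrDr.
rewrite !big_split/=.
by rewrite [X in X + _ = _]addrACA [LHS]addrACA.
Qed.

Lemma pderivable_lie_derivative X T c i j :
  (forall k, pderivable2 (chart_img c) (fun v => X c v 0 k)) ->
  (forall k l, pderivable2 (chart_img c) (fun v => T c v k l)) ->
  pderivable (chart_img c) (fun v => lie_derivative X T c v i j).
Proof.
move=> dX dT; rewrite (_ : (fun v => _) = fun v =>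
   \sum_(k < n) X c v 0 k * partial k (fun v => T c v i j) v
     + \sum_(k < n) partial i (fun v => X c v 0 k) v * T c v k j
     + \sum_(k < n) partial j (fun v => X c v 0 k) v * T c v i k); last first.
  by apply/funext => v; rewrite mxE.
apply: pderivableD; first apply: pderivableD.
- apply: pderivable_sum => k; exact: pderivableM (dX k).1 ((dT i j).2 k).
- apply: pderivable_sum => k; exact: pderivableM ((dX k).2 i) (dT k j).1.
- apply: pderivable_sum => k; exact: pderivableM ((dX k).2 j) (dT i k).1.
Qed.

Lemma pderivable_vf_apply X (phi : scalar_field M) c :
  (forall k, pderivable2 (chart_img c) (fun v => X c v 0 k)) ->
  pderivable2 (chart_img c) (phi c) ->
  pderivable (chart_img c) (vf_apply X phi c).
Proof.
move=> dX [_ dphi]; apply: pderivable_sum => k.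
exact: pderivableM (dX k).1 (dphi k).
Qed.

End LieDerivative.

(** * Lie derivatives along a sum of lifts *)

Section ProductManifold.
Context (R : realType) (m n : nat) (M : atlas R m) (N : atlas R n).
Local Notation P := (prod_atlas M N).

Lemma prod_chart_imgE (c : chart P) w :
  chart_img c w <-> chart_img c.1 (lsubmx w) /\ chart_img c.2 (rsubmx w).
Proof.
split=> [[x [x1 x2] <-]|[[x x1 ex] [y y2 ey]]].
  by rewrite /= row_mxKl row_mxKr; split; [exists x.1|exists x.2].
by exists (x, y); rewrite //= ex ey hsubmxK.
Qed.

Lemma prod_chart_img_open (c : chart P) :
  open (chart_img c.1) -> open (chart_img c.2) -> open (chart_img c).
Proof.
move=> oM oN.
have -> : chart_img c = (@lsubmx R 1 m n @^-1` chart_img c.1) `&`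
                        (@rsubmx R 1 m n @^-1` chart_img c.2).
  by apply/seteqP; split=> w /prod_chart_imgE.
apply: openI; apply: open_comp => // w _.
  exact: continuous_lsubmx.
exact: continuous_rsubmx.
Qed.

Definition scaled_pull2 (phi : scalar_field M) (T : tensor_field N) :
    tensor_field P :=
  fun c w => pull_scalar1 phi c w *: pull_tensor2 T c w.

Section LiftedField.
Variables (X : vector_field M) (Y : vector_field N).
Let Z : vector_field P := fun c w => lift1 X c w + lift2 Y c w.

Lemma sum_lift_l (c : chart P) w k :
  Z c w 0 (lshift n k) = X c.1 (lsubmx w) 0 k.
Proof. by rewrite mxE row_mxEl row_mxEl mxE addr0. Qed.

Lemma sum_lift_r (c : chart P) w k :
  Z c w 0 (rshift m k) = Y c.2 (rsubmx w) 0 k.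
Proof. by rewrite mxE row_mxEr row_mxEr mxE add0r. Qed.

Lemma sum_lift_apply (c : chart P) w F :
  \sum_k Z c w 0 k * partial k F w =
  \sum_k X c.1 (lsubmx w) 0 k * partial (lshift n k) F w
  + \sum_k Y c.2 (rsubmx w) 0 k * partial (rshift m k) F w.
Proof.
rewrite big_split_ord; congr (_ + _); apply: eq_bigr => k _.
  by rewrite sum_lift_l.
by rewrite sum_lift_r.
Qed.

(** The matrix of partial derivatives of a sum of lifts is block diagonal: the
    base components do not depend on the fiber coordinates, nor the fiber
    components on the base coordinates. Half of the sum thus vanishes. *)
Lemma sum_lift_partial_l (c : chart P) w i (a : 'I_(m + n) -> R) :
  \sum_k partial (lshift n i) (fun v => Z c v 0 k) w * a k =
  \sum_k partial i (fun v => X c.1 v 0 k) (lsubmx w) * a (lshift n k).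
Proof.
rewrite big_split_ord /= [X in _ + X]big1 ?addr0 => [|k _].
  apply: eq_bigr => k _; congr (_ * _).
  by rewrite -partial_l_lsub; apply: partial_ext => v; exact: sum_lift_l.
rewrite (partial_ext (G := fun v => Y c.2 (rsubmx v) 0 k)).
  by rewrite (partial_l_rsub (fun v => Y c.2 v 0 k)) mul0r.
by move=> v; exact: sum_lift_r.
Qed.

Lemma sum_lift_partial_r (c : chart P) w i (a : 'I_(m + n) -> R) :
  \sum_k partial (rshift m i) (fun v => Z c v 0 k) w * a k =
  \sum_k partial i (fun v => Y c.2 v 0 k) (rsubmx w) * a (rshift m k).
Proof.
rewrite big_split_ord /= [X in X + _]big1 ?add0r => [|k _].
  apply: eq_bigr => k _; congr (_ * _).
  by rewrite -partial_r_rsub; apply: partial_ext => v; exact: sum_lift_r.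
rewrite (partial_ext (G := fun v => X c.1 (lsubmx v) 0 k)).
  by rewrite (partial_r_lsub (fun v => X c.1 v 0 k)) mul0r.
by move=> v; exact: sum_lift_l.
Qed.

Lemma pull_tensor1_ll (T : tensor_field M) (c : chart P) w a b :
  pull_tensor1 T c w (lshift n a) (lshift n b) = T c.1 (lsubmx w) a b.
Proof. exact: block_mxEul. Qed.

Lemma pull_tensor1_r (T : tensor_field M) (c : chart P) w a b :
  pull_tensor1 T c w (rshift m a) b = 0.
Proof.
by case: (split_ordP b) => d ->; rewrite (block_mxEdl, block_mxEdr) mxE.
Qed.

Lemma pull_tensor1_lr (T : tensor_field M) (c : chart P) w a b :
  pull_tensor1 T c w a (rshift m b) = 0.
Proof.
by case: (split_ordP a) => d ->; rewrite (block_mxEur, block_mxEdr) mxE.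
Qed.

Lemma pull_tensor2_rr (T : tensor_field N) (c : chart P) w a b :
  pull_tensor2 T c w (rshift m a) (rshift m b) = T c.2 (rsubmx w) a b.
Proof. exact: block_mxEdr. Qed.

Lemma pull_tensor2_l (T : tensor_field N) (c : chart P) w a b :
  pull_tensor2 T c w (lshift n a) b = 0.
Proof.
by case: (split_ordP b) => d ->; rewrite (block_mxEul, block_mxEur) mxE.
Qed.

Lemma pull_tensor2_rl (T : tensor_field N) (c : chart P) w a b :
  pull_tensor2 T c w a (lshift n b) = 0.
Proof.
by case: (split_ordP a) => d ->; rewrite (block_mxEul, block_mxEdl) mxE.
Qed.

(* The four blocks of the Lie derivative of an arbitrary tensor field on the
   product, with the terms that vanish by block diagonality dropped. *)

Lemma lie_derivative_ll (S : tensor_field P) (c : chart P) w a b :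
  lie_derivative Z S c w (lshift n a) (lshift n b) =
  \sum_k X c.1 (lsubmx w) 0 k
    * partial (lshift n k) (fun v => S c v (lshift n a) (lshift n b)) w
  + \sum_k Y c.2 (rsubmx w) 0 k
    * partial (rshift m k) (fun v => S c v (lshift n a) (lshift n b)) w
  + \sum_k partial a (fun v => X c.1 v 0 k) (lsubmx w)
    * S c w (lshift n k) (lshift n b)
  + \sum_k partial b (fun v => X c.1 v 0 k) (lsubmx w)
    * S c w (lshift n a) (lshift n k).
Proof.
rewrite mxE; congr (_ + _ + _); first exact: sum_lift_apply.
  exact: (sum_lift_partial_l _ _ _ (fun k => S c w k (lshift n b))).
exact: (sum_lift_partial_l _ _ _ (fun k => S c w (lshift n a) k)).
Qed.

Lemma lie_derivative_lr (S : tensor_field P) (c : chart P) w a b :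
  lie_derivative Z S c w (lshift n a) (rshift m b) =
  \sum_k X c.1 (lsubmx w) 0 k
    * partial (lshift n k) (fun v => S c v (lshift n a) (rshift m b)) w
  + \sum_k Y c.2 (rsubmx w) 0 k
    * partial (rshift m k) (fun v => S c v (lshift n a) (rshift m b)) w
  + \sum_k partial a (fun v => X c.1 v 0 k) (lsubmx w)
    * S c w (lshift n k) (rshift m b)
  + \sum_k partial b (fun v => Y c.2 v 0 k) (rsubmx w)
    * S c w (lshift n a) (rshift m k).
Proof.
rewrite mxE; congr (_ + _ + _); first exact: sum_lift_apply.
  exact: (sum_lift_partial_l _ _ _ (fun k => S c w k (rshift m b))).
exact: (sum_lift_partial_r _ _ _ (fun k => S c w (lshift n a) k)).
Qed.

Lemma lie_derivative_rl (S : tensor_field P) (c : chart P) w a b :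
  lie_derivative Z S c w (rshift m a) (lshift n b) =
  \sum_k X c.1 (lsubmx w) 0 k
    * partial (lshift n k) (fun v => S c v (rshift m a) (lshift n b)) w
  + \sum_k Y c.2 (rsubmx w) 0 k
    * partial (rshift m k) (fun v => S c v (rshift m a) (lshift n b)) w
  + \sum_k partial a (fun v => Y c.2 v 0 k) (rsubmx w)
    * S c w (rshift m k) (lshift n b)
  + \sum_k partial b (fun v => X c.1 v 0 k) (lsubmx w)
    * S c w (rshift m a) (lshift n k).
Proof.
rewrite mxE; congr (_ + _ + _); first exact: sum_lift_apply.
  exact: (sum_lift_partial_r _ _ _ (fun k => S c w k (lshift n b))).
exact: (sum_lift_partial_l _ _ _ (fun k => S c w (rshift m a) k)).
Qed.

Lemma lie_derivative_rr (S : tensor_field P) (c : chart P) w a b :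
  lie_derivative Z S c w (rshift m a) (rshift m b) =
  \sum_k X c.1 (lsubmx w) 0 k
    * partial (lshift n k) (fun v => S c v (rshift m a) (rshift m b)) w
  + \sum_k Y c.2 (rsubmx w) 0 k
    * partial (rshift m k) (fun v => S c v (rshift m a) (rshift m b)) w
  + \sum_k partial a (fun v => Y c.2 v 0 k) (rsubmx w)
    * S c w (rshift m k) (rshift m b)
  + \sum_k partial b (fun v => Y c.2 v 0 k) (rsubmx w)
    * S c w (rshift m a) (rshift m k).
Proof.
rewrite mxE; congr (_ + _ + _); first exact: sum_lift_apply.
  exact: (sum_lift_partial_r _ _ _ (fun k => S c w k (rshift m b))).
exact: (sum_lift_partial_r _ _ _ (fun k => S c w (rshift m a) k)).
Qed.

(** Pulling back along the projection to the base commutes with Lie derivatives,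
    since the sum of lifts is related to [X] by this projection. *)
Lemma lie_derivative_pull1 (T : tensor_field M) (c : chart P) w :
  lie_derivative Z (pull_tensor1 T) c w = pull_tensor1 (lie_derivative X T) c w.
Proof.
apply/matrixP => i j.
case: (split_ordP i) => a ->; case: (split_ordP j) => b ->.
- rewrite lie_derivative_ll pull_tensor1_ll mxE; congr (_ + _ + _).
  + rewrite [X in _ + X]big1 => [|k _]; last first.
      rewrite (partial_ext _ _ (fun v => pull_tensor1_ll T c v a b)).
      by rewrite (partial_r_lsub (fun v => T c.1 v a b)) mulr0.
    rewrite addr0; apply: eq_bigr => k _; congr (_ * _).
    rewrite (partial_ext _ _ (fun v => pull_tensor1_ll T c v a b)).
    exact: (partial_l_lsub (fun v => T c.1 v a b)).
  + by apply: eq_bigr => k _; rewrite pull_tensor1_ll.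
  + by apply: eq_bigr => k _; rewrite pull_tensor1_ll.
- rewrite lie_derivative_lr pull_tensor1_lr; rewrite !big1 ?addr0// => k _;
    rewrite ?pull_tensor1_lr ?mulr0// partial_fun0 ?mulr0// => v;
    exact: pull_tensor1_lr.
- rewrite lie_derivative_rl pull_tensor1_r; rewrite !big1 ?addr0// => k _;
    rewrite ?pull_tensor1_r ?mulr0// partial_fun0 ?mulr0// => v;
    exact: pull_tensor1_r.
- rewrite lie_derivative_rr pull_tensor1_r; rewrite !big1 ?addr0// => k _;
    rewrite ?pull_tensor1_r ?mulr0// partial_fun0 ?mulr0// => v;
    exact: pull_tensor1_r.
Qed.

Section ScaledPullback.
Variables (phi : scalar_field M) (T : tensor_field N).
Local Notation S := (scaled_pull2 phi T).

Lemma scaled_pull2_rr (c : chart P) w a b :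
  S c w (rshift m a) (rshift m b) =
  phi c.1 (lsubmx w) * T c.2 (rsubmx w) a b.
Proof. by rewrite mxE pull_tensor2_rr. Qed.

Lemma scaled_pull2_l (c : chart P) w a b : S c w (lshift n a) b = 0.
Proof. by rewrite mxE pull_tensor2_l mulr0. Qed.

Lemma scaled_pull2_rl (c : chart P) w a b : S c w a (lshift n b) = 0.
Proof. by rewrite mxE pull_tensor2_rl mulr0. Qed.

Lemma derivable_scaled_pull2 (c : chart P) w i j k :
  (forall l, derivable (phi c.1) (lsubmx w) (delta_mx 0 l)) ->
  (forall a b l, derivable (fun v => T c.2 v a b) (rsubmx w) (delta_mx 0 l)) ->
  derivable (fun v => S c v i j) w (delta_mx 0 k).
Proof.
move=> dphi dT.
case: (split_ordP i) => a ->.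
  rewrite (_ : (fun v => _) = cst 0); first exact: derivable_cst.
  by apply/funext => v; exact: scaled_pull2_l.
case: (split_ordP j) => b ->.
  rewrite (_ : (fun v => _) = cst 0); first exact: derivable_cst.
  by apply/funext => v; exact: scaled_pull2_rl.
rewrite (funext (fun v => scaled_pull2_rr c v a b)).
apply: derivableM; first exact: derivable_lsub.
exact: (derivable_rsub (dT a b)).
Qed.

(** Leibniz rule: [phi] is differentiated by the base field and the pulled back
    tensor by the fiber field. All mixed terms vanish. *)
Lemma lie_derivative_scaled_pull2 (c : chart P) w :
  (forall l, derivable (phi c.1) (lsubmx w) (delta_mx 0 l)) ->
  (forall a b l, derivable (fun v => T c.2 v a b) (rsubmx w) (delta_mx 0 l)) ->
  lie_derivative Z S c w =
  scaled_pull2 (vf_apply X phi) T c w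
  + scaled_pull2 phi (lie_derivative Y T) c w.
Proof.
move=> dphi dT; apply/matrixP => i j.
rewrite [RHS]mxE [X in _ = X + _]mxE [X in _ = _ + X]mxE.
case: (split_ordP i) => a ->; case: (split_ordP j) => b ->.
- rewrite lie_derivative_ll !pull_tensor2_l !mulr0.
  rewrite !big1 ?addr0// => k _;
    rewrite ?scaled_pull2_l ?mulr0// partial_fun0 ?mulr0// => v;
    exact: scaled_pull2_l.
- rewrite lie_derivative_lr !pull_tensor2_l !mulr0.
  rewrite !big1 ?addr0// => k _;
    rewrite ?scaled_pull2_l ?mulr0// partial_fun0 ?mulr0// => v;
    exact: scaled_pull2_l.
- rewrite lie_derivative_rl !pull_tensor2_rl !mulr0.
  rewrite !big1 ?addr0// => k _;
    rewrite ?scaled_pull2_rl ?mulr0// partial_fun0 ?mulr0// => v;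
    exact: scaled_pull2_rl.
have dF := derivable_lsub dphi; have dG := derivable_rsub (dT a b).
have partial_l k :
    partial (lshift n k) (fun v => S c v (rshift m a) (rshift m b)) w =
    T c.2 (rsubmx w) a b * partial k (phi c.1) (lsubmx w).
  rewrite (partial_ext _ _ (fun v => scaled_pull2_rr c v a b)).
  rewrite (partialM (dF _) (dG _)) (partial_l_rsub (fun v => T c.2 v a b)).
  by rewrite mulr0 add0r partial_l_lsub.
have partial_r k :
    partial (rshift m k) (fun v => S c v (rshift m a) (rshift m b)) w =
    phi c.1 (lsubmx w) * partial k (fun v => T c.2 v a b) (rsubmx w).
  rewrite (partial_ext _ _ (fun v => scaled_pull2_rr c v a b)).
  rewrite (partialM (dF _) (dG _)) (partial_r_lsub (phi c.1)) mulr0 addr0.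
  by rewrite (partial_r_rsub (fun v => T c.2 v a b)).
rewrite lie_derivative_rr !pull_tensor2_rr mxE.
rewrite /pull_scalar1 /vf_apply !mulrDr !mulr_sumr mulr_suml -!addrA.
congr (_ + (_ + (_ + _))); apply: eq_bigr => k _.
- by rewrite partial_l [T _ _ _ _ * _]mulrC mulrA.
- by rewrite partial_r mulrCA.
- by rewrite scaled_pull2_rr mulrCA.
- by rewrite scaled_pull2_rr mulrCA.
Qed.

End ScaledPullback.
End LiftedField.
End ProductManifold.

(** * The 2-Killing equation on a warped product *)

Section WarpedProduct.
Context (R : realType) (m n : nat) (M : atlas R m) (N : atlas R n).
Local Notation P := (prod_atlas M N).

Lemma derivable_pull1 (T : tensor_field M) (c : chart P) w i j k :
  (forall a b l, derivable (fun v => T c.1 v a b) (lsubmx w) (delta_mx 0 l)) ->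
  derivable (fun v => pull_tensor1 T c v i j : R) w (delta_mx 0 k).
Proof.
move=> dT; case: (split_ordP i) => a ->; last first.
  rewrite (_ : (fun v => _) = cst 0); first exact: derivable_cst.
  by apply/funext => v; exact: pull_tensor1_r.
case: (split_ordP j) => b ->; last first.
  rewrite (_ : (fun v => _) = cst 0); first exact: derivable_cst.
  by apply/funext => v; exact: pull_tensor1_lr.
rewrite (funext (fun v => pull_tensor1_ll T c v a b)).
exact: (derivable_lsub (dT a b)).
Qed.

Lemma chart_img_inhabited p (Q : atlas R p) : smooth_manifold Q ->
  exists (c : chart Q) (u : 'rV[R]_p), chart_img c u.
Proof.
move=> hQ; have [x _] := manifold_nonempty hQ.
by have [c cx] := manifold_cover hQ x; exists c, (chart_map c x), x.
Qed.

Section TwoKilling.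
Variables (g1 : tensor_field M) (g2 : tensor_field N) (f : points M -> R).
Variables (X : vector_field M) (Y : vector_field N) (zeta : vector_field P).
Hypothesis manifoldM : smooth_manifold M.
Hypothesis manifoldN : smooth_manifold N.
Hypothesis metric_g1 : riemannian_metric g1.
Hypothesis metric_g2 : riemannian_metric g2.
Hypothesis smooth_f : smooth_fun f.
Hypothesis smooth_X : smooth_vector_field X.
Hypothesis smooth_Y : smooth_vector_field Y.
Hypothesis zetaE : vector_eq zeta (fun c w => lift1 X c w + lift2 Y c w).

Let f2 : scalar_field M := local_expr (fun x => f x ^+ 2).

Lemma sqr_pderivable2 (c : chart M) : pderivable2 (chart_img c) (f2 c).
Proof.
have df := smooth_on_pderivable2 (@smooth_f c).
exact: (pderivable2M (chart_img_open manifoldM (c := c)) df df).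
Qed.

Lemma lie_derivative_sum_lift (S T : tensor_field P) (c : chart P) w :
  chart_img c w -> (forall v, chart_img c v -> S c v = T c v) ->
  lie_derivative zeta S c w =
  lie_derivative (fun c w => lift1 X c w + lift2 Y c w) T c w.
Proof.
move=> cw ST.
have oc : open (chart_img c).
  apply: prod_chart_img_open.
    exact: (chart_img_open manifoldM).
  exact: (chart_img_open manifoldN).
by apply: lie_derivative_eq_on oc cw _ ST => v; exact: zetaE.
Qed.

Lemma lie_derivative_warped (c : chart P) w : chart_img c w ->
  lie_derivative zeta (warped_metric g1 f g2) c w =
  pull_tensor1 (lie_derivative X g1) c w
  + (scaled_pull2 (vf_apply X f2) g2 c w
     + scaled_pull2 f2 (lie_derivative Y g2) c w).
Proof.
move=> cw; have [cw1 cw2] := (prod_chart_imgE c w).1 cw.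
have df2 l : derivable (f2 c.1) (lsubmx w) (delta_mx 0 l).
  exact: (sqr_pderivable2 c.1).1 cw1 l.
have dg1 a b l : derivable (fun v => g1 c.1 v a b) (lsubmx w) (delta_mx 0 l).
  have sg1 := @metric_smooth _ _ _ _ metric_g1 c.1 a b.
  exact: (smooth_on_pderivable2 sg1).1 cw1 l.
have dg2 a b l : derivable (fun v => g2 c.2 v a b) (rsubmx w) (delta_mx 0 l).
  have sg2 := @metric_smooth _ _ _ _ metric_g2 c.2 a b.
  exact: (smooth_on_pderivable2 sg2).1 cw2 l.
rewrite (lie_derivative_sum_lift
  (T := fun c w => pull_tensor1 g1 c w + scaled_pull2 f2 g2 c w))//.
rewrite lie_derivativeD.
- by rewrite lie_derivative_pull1 lie_derivative_scaled_pull2.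
- by move=> i j k; exact: derivable_pull1.
- by move=> i j k; exact: derivable_scaled_pull2.
Qed.

(** The two middle terms coincide: one comes from differentiating the metric in
    the term with coefficient zeta1 (f^2), the other from differentiating the
    coefficient f^2 of the Lie derivative of the metric. They make up the
    factor 2 in the fiber equation. *)
Lemma lie_derivative2_warped (c : chart P) w : chart_img c w ->
  lie_derivative zeta (lie_derivative zeta (warped_metric g1 f g2)) c w =
  pull_tensor1 (lie_derivative X (lie_derivative X g1)) c w
  + (scaled_pull2 (vf_apply X (vf_apply X f2)) g2 c w
     + scaled_pull2 (vf_apply X f2) (lie_derivative Y g2) c w
     + (scaled_pull2 (vf_apply X f2) (lie_derivative Y g2) c w
        + scaled_pull2 f2 (lie_derivative Y (lie_derivative Y g2)) c w)).
Proof.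
move=> cw; have [cw1 cw2] := (prod_chart_imgE c w).1 cw.
have dX c' k :=
  smooth_on_pderivable2 (@vector_field_smooth _ _ _ _ smooth_X c' k).
have dY c' k :=
  smooth_on_pderivable2 (@vector_field_smooth _ _ _ _ smooth_Y c' k).
have d2g1 c' a b :=
  smooth_on_pderivable2 (@metric_smooth _ _ _ _ metric_g1 c' a b).
have d2g2 c' a b :=
  smooth_on_pderivable2 (@metric_smooth _ _ _ _ metric_g2 c' a b).
have df2 l : derivable (f2 c.1) (lsubmx w) (delta_mx 0 l).
  exact: (sqr_pderivable2 c.1).1 cw1 l.
have dXf2 l : derivable (vf_apply X f2 c.1) (lsubmx w) (delta_mx 0 l).
  exact: pderivable_vf_apply (dX c.1) (sqr_pderivable2 c.1) _ cw1 l.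
have dg2 a b l : derivable (fun v => g2 c.2 v a b) (rsubmx w) (delta_mx 0 l).
  exact: (d2g2 c.2 a b).1 cw2 l.
have dLg1 a b l : derivable (fun v => lie_derivative X g1 c.1 v a b)
    (lsubmx w) (delta_mx 0 l).
  exact: pderivable_lie_derivative a b (dX c.1) (d2g1 c.1) _ cw1 l.
have dLg2 a b l : derivable (fun v => lie_derivative Y g2 c.2 v a b)
    (rsubmx w) (delta_mx 0 l).
  exact: pderivable_lie_derivative a b (dY c.2) (d2g2 c.2) _ cw2 l.
pose S1 := scaled_pull2 (N := N) (vf_apply X f2) g2.
pose S2 := scaled_pull2 f2 (lie_derivative Y g2).
have dS1 i j k : derivable (fun v => S1 c v i j) w (delta_mx 0 k).
  exact: (derivable_scaled_pull2 dXf2 dg2).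
have dS2 i j k : derivable (fun v => S2 c v i j) w (delta_mx 0 k).
  exact: (derivable_scaled_pull2 df2 dLg2).
rewrite (lie_derivative_sum_lift
  (T := fun c w => pull_tensor1 (lie_derivative X g1) c w
                   + (S1 c w + S2 c w)) cw); last first.
  by move=> v; exact: lie_derivative_warped.
rewrite lie_derivativeD.
- rewrite lie_derivativeD//.
  by rewrite lie_derivative_pull1 !lie_derivative_scaled_pull2.
- by move=> i j k; exact: derivable_pull1.
- move=> i j k.
  rewrite (_ : (fun v => _) =
      (fun v => S1 c v i j) + (fun v => S2 c v i j)).
    exact: derivableD.
  by apply/funext => v; rewrite mxE.
Qed.

Hypothesis killing : two_killing (warped_metric g1 f g2) zeta.

(** Upper left block of the 2-Killing equation, read at an arbitrary point of
    the fiber. *)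
Lemma two_killing_base :
  tensor_eq (lie_derivative X (lie_derivative X g1)) (fun _ _ => 0).
Proof.
move=> c u cu; have [d [v dv]] := chart_img_inhabited manifoldN.
have cw : chart_img ((c, d) : chart P) (row_mx u v).
  by apply/prod_chart_imgE; rewrite row_mxKl row_mxKr.
have := killing cw; rewrite lie_derivative2_warped// => /(congr1 ulsubmx).
rewrite /scaled_pull2 /pull_tensor1 /pull_tensor2 !scale_block_mx !add_block_mx.
rewrite block_mxKul !scaler0 !addr0 row_mxKl => ->.
by apply/matrixP => i j; rewrite !mxE.
Qed.

(** Lower right block of the 2-Killing equation. *)
Lemma two_killing_fiber (c : chart M) (u : 'rV[R]_m) (d : chart N)
    (v : 'rV[R]_n) : chart_img c u -> chart_img d v ->
  vf_apply X (vf_apply X f2) c u *: g2 d v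
  + (2 * vf_apply X f2 c u) *: lie_derivative Y g2 d v
  + f2 c u *: lie_derivative Y (lie_derivative Y g2) d v = 0.
Proof.
move=> cu dv.
have cw : chart_img ((c, d) : chart P) (row_mx u v).
  by apply/prod_chart_imgE; rewrite row_mxKl row_mxKr.
have := killing cw; rewrite lie_derivative2_warped// => /(congr1 drsubmx).
rewrite /scaled_pull2 /pull_tensor1 /pull_tensor2 /pull_scalar1.
rewrite !scale_block_mx !add_block_mx.
rewrite block_mxKdr add0r row_mxKl row_mxKr /= => killing_dr.
rewrite mulr_natl mulr2n scalerDl [X in X + _]addrA -[LHS]addrA killing_dr.
by apply/matrixP => i j; rewrite !mxE.
Qed.

End TwoKilling.
End WarpedProduct.

(** * From soliton equations to quotients *)

(** Here [L] and [LL] stand for the first and second Lie derivatives of the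
    metric [G] of the fiber. Multiplying the soliton equation by [phi] and
    eliminating [phi *: LL] leaves an equation between multiples of [L] and [G];
    each step is reversible because [phi] and the denominator are nonzero. *)
Lemma soliton_quotientP (F : fieldType) (V : lmodType F)
    (phi z zz lam s : F) (G L LL : V) :
  phi != 0 -> lam * phi - 2 * z != 0 ->
  zz *: G + (2 * z) *: L + phi *: LL = 0 ->
  LL + lam *: L = s *: G <->
  L = ((s * phi + zz) / (lam * phi - 2 * z)) *: G.
Proof.
move=> phi_neq0 den_neq0 killing.
have key : phi *: (LL + lam *: L - s *: G) =
    (lam * phi - 2 * z) *: L - (s * phi + zz) *: G.
  (* The 2-Killing equation, solved for the second Lie derivative. *)
  have -> : LL = phi^-1 *: - (zz *: G + (2 * z) *: L).
    apply/(canRL (scalerK phi_neq0))/eqP; rewrite -addr_eq0 addrC.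
    exact/eqP.
  rewrite scalerBr scalerDr scalerKV// !scalerA ![phi * _]mulrC.
  rewrite scalerBl scalerDl !opprD.
  by rewrite [LHS](ACl ((3*2)*(4*1))).
split=> [soliton|quotient].
  have /eqP := key; rewrite soliton subrr scaler0 eq_sym subr_eq0 => /eqP dL.
  by rewrite mulrC -scalerA -dL scalerK.
apply/eqP; rewrite -subr_eq0; apply/eqP/(scalerI phi_neq0); rewrite scaler0.
rewrite key {1}quotient scalerA.
by rewrite [X in X *: G]mulrC divfK// subrr.
Qed.

Theorem proposition4p4 (R : realType) (n1 n2 : nat)
    (M1 : atlas R n1) (M2 : atlas R n2)
    (hM1 : smooth_manifold M1) (hM2 : smooth_manifold M2)
    (g1 : tensor_field M1) (g2 : tensor_field M2)
    (hg1 : riemannian_metric g1) (hg2 : riemannian_metric g2)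
    (f : points M1 -> R) (hf : smooth_fun f) (f_gt0 : forall x, 0 < f x)
    (zeta1 : vector_field M1) (zeta2 : vector_field M2)
    (hzeta1 : smooth_vector_field zeta1) (hzeta2 : smooth_vector_field zeta2)
    (zeta : vector_field (prod_atlas M1 M2))
    (hzeta : vector_eq zeta (fun c w => lift1 zeta1 c w + lift2 zeta2 c w))
    (hkilling : two_killing (warped_metric g1 f g2) zeta) :
  let r1 := scalar_curvature g1 in
  let r2 := scalar_curvature g2 in
  let f2 := local_expr (fun x => f x ^+ 2) in
  let zf2 := vf_apply zeta1 f2 in
  let zzf2 := vf_apply zeta1 zf2 in
  let pull1 := @pull_scalar1 R n1 n2 M1 M2 in
  let pull2 := @pull_scalar2 R n1 n2 M1 M2 in
  let admissible (lam : R) :=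
    forall (c : chart M1) (u : 'rV[R]_n1),
      chart_img c u -> lam * f2 c u <> 2 * zf2 c u in
  ((exists lam mu : R, lam <> 0 /\ hyperbolic_yamabe_soliton g1 zeta1 lam mu)
   <->
   (exists lam mu : R, lam <> 0 /\
      tensor_eq (lie_derivative zeta1 g1)
        (fun c u => ((mu - r1 c u) / lam) *: g1 c u)))
  /\
  ((exists lam mu : R,
      admissible lam /\ hyperbolic_yamabe_soliton g2 zeta2 lam mu)
   <->
   (exists lam mu : R, admissible lam /\
      tensor_eq (pull_tensor2 (lie_derivative zeta2 g2))
        (fun c w =>
           (((mu - pull2 r2 c w) * pull1 f2 c w + pull1 zzf2 c w)
            / (lam * pull1 f2 c w - 2 * pull1 zf2 c w))
           *: pull_tensor2 (M := M1) g2 c w))).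
Proof.
move=> r1 r2 f2 zf2 zzf2 pull1 pull2 admissible.
have base := two_killing_base hM1 hM2 hg1 hg2 hf hzeta1 hzeta2 hzeta hkilling.
have fiber := two_killing_fiber hM1 hM2 hg1 hg2 hf hzeta1 hzeta2 hzeta hkilling.
have f2_neq0 c u : f2 c u != 0 by rewrite expf_neq0// gt_eqF.
have den_neq0 lam c u : admissible lam -> chart_img c u ->
    lam * f2 c u - 2 * zf2 c u != 0.
  by move=> adm cu; rewrite subr_eq0; apply/eqP; exact: adm.
split; split=> -[lam [mu [lam_ok H]]]; exists lam, mu; split=> //.
- move=> c u cu; have := H c u cu; rewrite base// add0r => lamL.
  by rewrite mulrC -scalerA -lamL scalerK//; apply/eqP.
- move=> c u cu; rewrite base// add0r H// scalerA mulrC divfK//.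
  exact/eqP.
- move=> c w /prod_chart_imgE[cw1 cw2].
  rewrite /pull_tensor2 scale_block_mx !scaler0; congr block_mx.
  apply/(soliton_quotientP _ _ _ (fiber _ _ _ _ cw1 cw2)) => //.
  + exact: den_neq0.
  + exact: H.
(* The equation on the fiber is read at an arbitrary point of the base. *)
- move=> d v dv; have [c [u cu]] := chart_img_inhabited hM1.
  apply/(soliton_quotientP _ _ _ (fiber _ _ _ _ cu dv)) => //.
    exact: den_neq0.
  have cw : chart_img ((c, d) : chart (prod_atlas M1 M2)) (row_mx u v).
    by apply/prod_chart_imgE; rewrite row_mxKl row_mxKr.
  have /(congr1 drsubmx) := H _ _ cw.
  rewrite /pull_tensor2 scale_block_mx !block_mxKdr.
  by rewrite /pull1 /pull2 /pull_scalar1 /pull_scalar2 row_mxKl row_mxKr.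
Qed.
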